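(* Let $A$ be a finite dimensional $k$-algebra. Then $A$ is gendo-Frobenius if and only if there exists an automorphism $\sigma\in\mathrm{Aut}(A)$ such that $\mathrm{D}(A)_{\sigma^{-1}}\otimes_A \mathrm{D}(A)\cong \mathrm{D}(A)$ as $A$-bimodules, and such a $\sigma$ is uniquely determined up to an inner automorphism.
   Context: $k$ is an arbitrary field; all algebras and modules are finite dimensional over $k$. $\mathrm{D}=\mathrm{Hom}_k(-,k)$; $\mathrm{D}(A)$ is an $A$-bimodule via $(afb)(x)=f(bxa)$. $\mathrm{Aut}(A)$ is the group of $k$-algebra automorphisms of $A$. For $\omega\in\mathrm{Aut}(A)$ and a right module $N$, $N_\omega$ is the vector space $N$ with right action $n\cdot a=n\,\omega(a)$; for a bimodule the left action is unchanged. A finite dimensional $k$-algebra $B$ is Frobenius if $B\cong \mathrm{D}(B)$ as left (equivalently right) $B$-modules. A Nakayama automorphism $\nu_B$ of a Frobenius algebra $B$ is an automorphism with $B_{\nu_B}\cong \mathrm{D}(B)$ as $B$-bimodules (it exists and is unique up to inner automorphisms). A finite dimensional $k$-algebra $A$ is called gendo-Frobenius if it satisfies one of the following equivalent conditions (the equivalence is a theorem of Kerner and Yamagata): (i) $A$ is isomorphic to $\mathrm{End}_B(M)$ for a finite dimensional faithful right module $M$ over a Frobenius algebra $B$ such that $M\cong M_{\nu_B}$ as right $B$-modules; (ii) $\mathrm{Hom}_A(\mathrm{D}(A),A)\cong A$ as left $A$-modules, where $\mathrm{Hom}_A$ denotes homomorphisms of left $A$-modules and the left $A$-action is $(af)(x)=f(xa)$.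 *)

(* Defs.v *)
From HB Require Import structures.
From mathcomp Require Import all_boot all_algebra all_field.

Set Implicit Arguments.
Unset Strict Implicit.
Unset Printing Implicit Defensive.

Import GRing.Theory VectorInternalTheory.
Local Open Scope ring_scope.

(* Finite dimensional modules over a finite dimensional k-algebra A are given *)
(* as representations: a finite dimensional k-space together with a k-linear  *)
(* map from A to its endomorphisms. In particular k acts centrally on a       *)
(* bimodule.                                                                  *)

Record lmodule (k : fieldType) (A : falgType k) := LModule {
  lmod_sort :> vectType k;
  lmod_act : {linear A -> 'End(lmod_sort)};
  lmod_act1 : lmod_act 1 = \1%VF;
  lmod_actM : forall a b, lmod_act (a * b) = (lmod_act a \o lmod_act b)%VF }.

(* An A-B-bimodule; ract b is the endomorphism m |-> m b, whence the reversed *)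
(* composition in ractM.                                                      *)
Record bimodule (k : fieldType) (A B : falgType k) := Bimodule {
  bimod_sort :> vectType k;
  lact : {linear A -> 'End(bimod_sort)};
  ract : {linear B -> 'End(bimod_sort)};
  lact1 : lact 1 = \1%VF;
  lactM : forall a a', lact (a * a') = (lact a \o lact a')%VF;
  ract1 : ract 1 = \1%VF;
  ractM : forall b b', ract (b * b') = (ract b' \o ract b)%VF;
  lractC : forall a b, (lact a \o ract b = ract b \o lact a)%VF }.

Lemma lractCE (k : fieldType) (A B : falgType k) (M : bimodule A B) a b m :
  lact M a (ract M b m) = ract M b (lact M a m).
Proof. by rewrite -comp_lfunE lractC comp_lfunE. Qed.

Definition lmod_iso (k : fieldType) (A : falgType k) (M N : lmodule A) :=
  exists phi : 'Hom(M, N), bijective phi /\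
    forall a m, phi (lmod_act M a m) = lmod_act N a (phi m).

Definition bimod_iso (k : fieldType) (A B : falgType k) (M N : bimodule A B) :=
  exists phi : 'Hom(M, N), [/\ bijective phi,
    forall a m, phi (lact M a m) = lact N a (phi m) &
    forall b m, phi (ract M b m) = ract N b (phi m)].

Section Regular.
Variables (k : fieldType) (A : falgType k).

Definition regular_lmodule : lmodule A :=
  @LModule k A A (@amull k A) (@amull1 k A) (@amullM k A).

End Regular.

Section Precomposition.
Variables (k : fieldType) (U V W : vectType k).

Definition precomp_fun (g : 'Hom(U, V)) (f : 'Hom(V, W)) : 'Hom(U, W) :=
  (f \o g)%VF.

Fact precomp_fun_linear g : linear (precomp_fun g).
Proof.
by move=> c f f'; rewrite /precomp_fun comp_lfunDl -comp_lfunZl.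
Qed.
HB.instance Definition _ g := GRing.isLinear.Build k _ _ _ (precomp_fun g)
  (precomp_fun_linear g).

Definition precomp (g : 'Hom(U, V)) : 'Hom('Hom(V, W), 'Hom(U, W)) :=
  linfun (precomp_fun g).

Lemma precompE g f : precomp g f = (f \o g)%VF.
Proof. by rewrite lfunE. Qed.

Fact precomp_linear : linear precomp.
Proof.
move=> c g g'; apply/lfunP => f.
by rewrite add_lfunE scale_lfunE !precompE comp_lfunDr -comp_lfunZr.
Qed.
HB.instance Definition _ := GRing.isLinear.Build k _ _ _ precomp precomp_linear.

End Precomposition.

Definition precompl (k : fieldType) (U V W : vectType k) :
  {linear 'Hom(U, V) -> 'Hom('Hom(V, W), 'Hom(U, W))} := @precomp k U V W.

Definition lin_comp (k : fieldType) (U V W : vectType k)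
    (f : {linear V -> W}) (g : {linear U -> V}) : {linear U -> W} := f \o g.

(* The A-bimodule Hom_k(A, W): (a f b)(x) = f (b x a). *)
Section Coinduced.
Variables (k : fieldType) (A : falgType k) (W : vectType k).

Definition coind_lact : {linear A -> 'End('Hom(A, W))} :=
  lin_comp (@precompl k A A W) (@amulr k A).
Definition coind_ract : {linear A -> 'End('Hom(A, W))} :=
  lin_comp (@precompl k A A W) (@amull k A).

Lemma coind_lactE a f x : coind_lact a f x = f (x * a).
Proof. by rewrite /coind_lact /= precompE comp_lfunE lfunE. Qed.
Lemma coind_ractE a f x : coind_ract a f x = f (a * x).
Proof. by rewrite /coind_ract /= precompE comp_lfunE lfunE. Qed.

Fact coind_lact1 : coind_lact 1 = \1%VF.
Proof.
by apply/lfunP=> f; apply/lfunP=> x; rewrite coind_lactE mulr1 lfunE.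
Qed.
Fact coind_lactM a b : coind_lact (a * b) = (coind_lact a \o coind_lact b)%VF.
Proof.
apply/lfunP=> f; apply/lfunP=> x.
by rewrite coind_lactE comp_lfunE !coind_lactE mulrA.
Qed.
Fact coind_ract1 : coind_ract 1 = \1%VF.
Proof.
by apply/lfunP=> f; apply/lfunP=> x; rewrite coind_ractE mul1r lfunE.
Qed.
Fact coind_ractM a b : coind_ract (a * b) = (coind_ract b \o coind_ract a)%VF.
Proof.
apply/lfunP=> f; apply/lfunP=> x.
by rewrite coind_ractE comp_lfunE !coind_ractE mulrA.
Qed.
Fact coind_lractC a b :
  (coind_lact a \o coind_ract b = coind_ract b \o coind_lact a)%VF.
Proof.
apply/lfunP=> f; apply/lfunP=> x.
by rewrite !comp_lfunE coind_lactE !coind_ractE coind_lactE mulrA.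
Qed.

Definition coind_bimodule : bimodule A A :=
  Bimodule coind_lact1 coind_lactM coind_ract1 coind_ractM coind_lractC.

End Coinduced.

Definition dual_bimodule (k : fieldType) (A : falgType k) : bimodule A A :=
  coind_bimodule A k^o.

Record algAut (k : fieldType) (A : falgType k) := AlgAut {
  aut_val :> 'AEnd(A);
  aut_bij : bijective aut_val }.

Section AlgAutInv.
Variables (k : fieldType) (A : falgType k) (s : algAut A).

Fact aut_lker0 : lker s == 0%VS.
Proof. by apply/lker0P; apply: bij_inj (aut_bij s). Qed.

Fact aut_inv_is_ahom : ahom_in {:A} (s^-1)%VF.
Proof.
have sK := lker0_lfunK aut_lker0; have sVK := lker0_lfunVK aut_lker0.
apply/ahomP_tmp; split=> [|x y]; apply: (can_inj sK).
  by rewrite sVK rmorph1.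
by rewrite (rmorphM s) sVK; congr (_ * _); apply/esym/sVK.
Qed.

Fact aut_inv_bij : bijective (AHom aut_inv_is_ahom).
Proof.
exists s; [exact: lker0_lfunVK aut_lker0 | exact: lker0_lfunK aut_lker0].
Qed.

Definition aut_inv : algAut A := AlgAut aut_inv_bij.

Lemma aut_invK : cancel s aut_inv.
Proof. exact: lker0_lfunK aut_lker0. Qed.
Lemma aut_invVK : cancel aut_inv s.
Proof. exact: lker0_lfunVK aut_lker0. Qed.

End AlgAutInv.

(* M_w: same left action, and m . b = m w(b) *)
Section Twist.
Variables (k : fieldType) (A B : falgType k) (M : bimodule A B) (w : algAut B).

Let tr : {linear B -> 'End(M)} := lin_comp (ract M) w.

Fact twist_ract1 : tr 1 = \1%VF.
Proof. by rewrite /tr /= rmorph1 ract1. Qed.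
Fact twist_ractM b b' : tr (b * b') = (tr b' \o tr b)%VF.
Proof. by rewrite /tr /= rmorphM ractM. Qed.
Fact twist_lractC a b : (lact M a \o tr b = tr b \o lact M a)%VF.
Proof. exact: lractC. Qed.

Definition twist : bimodule A B :=
  Bimodule (lact1 M) (@lactM _ _ _ M) twist_ract1 twist_ractM twist_lractC.

Lemma twist_ractE b (m : M) : ract twist b m = ract M (w b) m.
Proof. by []. Qed.

End Twist.

(* The quotient V / R, realised on a complement of R. *)
Section QuotientSpace.
Variables (k : fieldType) (V : vectType k) (R : {vspace V}).

Definition quotv : vectType k := subvs_of (R^C)%VS.

Definition qpi : 'Hom(V, quotv) :=
  (linfun (@vsproj k V (R^C)%VS) \o daddv_pi (R^C) R)%VF.

Lemma val_qpi v : vsval (qpi v) = daddv_pi (R^C) R v.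
Proof. by rewrite comp_lfunE lfunE /= vsprojK ?memv_pi. Qed.

Let cR : (R^C :&: R = 0)%VS. Proof. by rewrite capvC capv_compl. Qed.

Lemma qpiK v : v - vsval (qpi v) \in R.
Proof.
rewrite val_qpi -{1}(daddv_pi_add (w := v) cR) 1?addvC ?addv_complf ?memvf //.
by rewrite addrAC subrr add0r memv_pi.
Qed.

Lemma qpi_val (x : quotv) : qpi (vsval x) = x.
Proof. by apply/val_inj; rewrite /= val_qpi daddv_pi_id ?subvsP. Qed.

Lemma qpi_eq0 v : (qpi v == 0) = (v \in R).
Proof.
have val0 : vsval (0 : quotv) = 0 by exact: linear0.
apply/eqP/idP=> [v0 | Rv]; first by have := qpiK v; rewrite v0 val0 subr0.
have: vsval (qpi v) \in (R^C :&: R)%VS.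
  rewrite memv_cap subvsP /=.
  by rewrite -[vsval _](subKr v) rpredB ?qpiK.
by rewrite cR memv0 => /eqP v0; apply/val_inj; rewrite /= v0.
Qed.

Definition quot_map_fun (f : 'End(V)) : 'End(quotv) :=
  (qpi \o f \o linfun vsval)%VF.

Fact quot_map_linear : linear quot_map_fun.
Proof.
move=> c f g; rewrite /quot_map_fun comp_lfunDr -comp_lfunZr comp_lfunDl.
by rewrite -comp_lfunZl.
Qed.
HB.instance Definition _ :=
  GRing.isLinear.Build k _ _ _ quot_map_fun quot_map_linear.

(* The endomorphism of V / R induced by f, meaningful when f preserves R. *)
Definition quot_map : {linear 'End(V) -> 'End(quotv)} := quot_map_fun.

Lemma quot_mapE (f : 'End(V)) v :
  (f @: R <= R)%VS -> quot_map f (qpi v) = qpi (f v).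
Proof.
move=> fR; rewrite /= /quot_map_fun (comp_lfunE (qpi \o f)) (comp_lfunE qpi).
rewrite [linfun vsval _]lfunE /=.
apply/eqP; rewrite eq_sym -subr_eq0 -(linearB qpi) qpi_eq0 -(linearB f).
by apply: (subvP fR); apply: memv_img; apply: qpiK.
Qed.

Lemma quot_lfunP (W : vectType k) (f g : 'Hom(quotv, W)) :
  (forall v, f (qpi v) = g (qpi v)) -> f = g.
Proof. by move=> fg; apply/lfunP=> x; rewrite -(qpi_val x) fg. Qed.

End QuotientSpace.

(* The tensor product over k, as matrices of coordinates, and the tensor      *)
(* product f (x) g of endomorphisms.                                          *)
Section TensorK.
Variables (k : fieldType) (V W : vectType k).

Definition tensk : vectType k := 'M[k]_(dim V, dim W).

Definition tk (v : V) (w : W) : tensk := (v2r v)^T *m v2r w.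

Definition tmap_fun (f : 'End(V)) (g : 'End(W)) (X : tensk) : tensk :=
  (f2mx f)^T *m X *m f2mx g.

Fact tmap_fun_linear f g : linear (tmap_fun f g).
Proof.
by move=> c X Y; rewrite /tmap_fun mulmxDr mulmxDl -scalemxAr -scalemxAl.
Qed.
HB.instance Definition _ f g :=
  GRing.isLinear.Build k _ _ _ (tmap_fun f g) (tmap_fun_linear f g).

Definition tmap f g : 'End(tensk) := linfun (tmap_fun f g).

Lemma tkE v w i j : tk v w i j = v2r v 0 i * v2r w 0 j.
Proof. by rewrite mxE big_ord1 mxE. Qed.

Lemma tensk_sum (X : tensk) :
  X = \sum_i \sum_j X i j *: tk (r2v (delta_mx 0 i)) (r2v (delta_mx 0 j)).
Proof.
rewrite {1}[X]matrix_sum_delta; apply: eq_bigr => i _; apply: eq_bigr => j _.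
by rewrite /tk !r2vK trmx_delta mul_delta_mx.
Qed.

Lemma v2r_lfun (U U' : vectType k) (f : 'Hom(U, U')) u :
  v2r (f u) = v2r u *m f2mx f.
Proof. by rewrite unlock /= r2vK. Qed.

Lemma tmap_tk f g v w : tmap f g (tk v w) = tk (f v) (g w).
Proof.
by rewrite lfunE /= /tmap_fun /tk !v2r_lfun trmx_mul !mulmxA.
Qed.

Lemma tensk_lfunP (U : vectType k) (h h' : 'Hom(tensk, U)) :
  (forall v w, h (tk v w) = h' (tk v w)) -> h = h'.
Proof.
move=> hh'; apply/lfunP=> X; rewrite [X]tensk_sum !linear_sum.
apply: eq_bigr => i _; rewrite !linear_sum; apply: eq_bigr => j _.
by rewrite !linearZ /= hh'.
Qed.

Lemma tk_linearl w : linear (tk^~ w).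
Proof. by move=> c v v'; rewrite /tk !linearP /= mulmxDl -scalemxAl. Qed.
Lemma tk_linearr v : linear (tk v).
Proof. by move=> c w w'; rewrite /tk linearP /= mulmxDr -scalemxAr. Qed.

Fact tmap_linearl : linear (tmap^~ \1%VF).
Proof.
move=> c f f'; apply: tensk_lfunP => v w.
rewrite add_lfunE scale_lfunE !tmap_tk add_lfunE scale_lfunE.
exact: (tk_linearl _ c (f v) (f' v)).
Qed.
Fact tmap_linearr : linear (tmap \1%VF).
Proof.
move=> c f f'; apply: tensk_lfunP => v w.
rewrite add_lfunE scale_lfunE !tmap_tk add_lfunE scale_lfunE.
exact: tk_linearr.
Qed.

Definition tmapl (f : 'End(V)) : 'End(tensk) := tmap f \1.
Definition tmapr (g : 'End(W)) : 'End(tensk) := tmap \1 g.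

HB.instance Definition _ := GRing.isLinear.Build k _ _ _ tmapl tmap_linearl.
HB.instance Definition _ := GRing.isLinear.Build k _ _ _ tmapr tmap_linearr.

Lemma tmapl_tk f v w : tmapl f (tk v w) = tk (f v) w.
Proof. by rewrite tmap_tk lfunE. Qed.
Lemma tmapr_tk g v w : tmapr g (tk v w) = tk v (g w).
Proof. by rewrite tmap_tk lfunE. Qed.

End TensorK.

(* M (x)_B N: the quotient of M (x)_k N by the subspace spanned by the        *)
(* elements (m b) (x) n - m (x) (b n). That subspace is the sum, over a basis *)
(* of B, of the images of the maps (. b) (x) 1 - 1 (x) (b .).                 *)
Section Tensor.
Variables (k : fieldType) (A B C : falgType k).
Variables (M : bimodule A B) (N : bimodule B C).

Definition tens_diff (b : B) : 'End(tensk M N) :=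
  tmapl N (ract M b) - tmapr M (lact N b).

Definition tens_rel : {vspace tensk M N} :=
  (\sum_(b <- vbasis {:B}) limg (tens_diff b))%VS.

Lemma tens_diff_tk b m n :
  tens_diff b (tk m n) = tk (ract M b m) n - tk m (lact N b n).
Proof. by rewrite add_lfunE opp_lfunE tmapl_tk tmapr_tk. Qed.

Fact tens_diff_linear : linear tens_diff.
Proof.
move=> c b b'; rewrite /tens_diff (linearP (ract M)) (linearP (lact N)) /=.
rewrite (linearP (@tmapl k M N)) (linearP (@tmapr k M N)) /=.
by rewrite scalerBr opprD addrACA.
Qed.
HB.instance Definition _ :=
  GRing.isLinear.Build k _ _ _ tens_diff tens_diff_linear.

Fact tens_rel_stable (f : 'End(tensk M N)) :
  (forall b, f \o tens_diff b = tens_diff b \o f)%VF ->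
  (f @: tens_rel <= tens_rel)%VS.
Proof.
move=> fC; rewrite /tens_rel big_tnth limg_sum; apply/subv_sumP => i _.
rewrite -limg_comp fC limg_comp.
by apply: subv_trans (sumv_sup i _ (subvv _)); rewrite // limgS ?subvf.
Qed.

Fact tens_lact_stable a : (tmapl N (lact M a) @: tens_rel <= tens_rel)%VS.
Proof.
apply: tens_rel_stable => b; apply: tensk_lfunP => m n.
rewrite !comp_lfunE tens_diff_tk linearB /= !tmapl_tk tens_diff_tk.
by rewrite lractCE.
Qed.

Fact tens_ract_stable c : (tmapr M (ract N c) @: tens_rel <= tens_rel)%VS.
Proof.
apply: tens_rel_stable => b; apply: tensk_lfunP => m n.
rewrite !comp_lfunE tens_diff_tk linearB /= !tmapr_tk tens_diff_tk.
by rewrite lractCE.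
Qed.

Definition tens_space : vectType k := quotv tens_rel.

Definition tens (m : M) (n : N) : tens_space := qpi tens_rel (tk m n).

Definition tens_lact : {linear A -> 'End(tens_space)} :=
  lin_comp (quot_map tens_rel) (lin_comp (@tmapl k M N) (lact M)).
Definition tens_ract : {linear C -> 'End(tens_space)} :=
  lin_comp (quot_map tens_rel) (lin_comp (@tmapr k M N) (ract N)).

Fact tens_lact_tens a m n : tens_lact a (tens m n) = tens (lact M a m) n.
Proof. by rewrite [LHS]quot_mapE ?tens_lact_stable // tmapl_tk. Qed.
Fact tens_ract_tens c m n : tens_ract c (tens m n) = tens m (ract N c n).
Proof. by rewrite [LHS]quot_mapE ?tens_ract_stable // tmapr_tk. Qed.
Local Opaque tens_lact tens_ract.

Fact tens_lfunP (U : vectType k) (h h' : 'Hom(tens_space, U)) :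
  (forall m n, h (tens m n) = h' (tens m n)) -> h = h'.
Proof.
move=> hh'; apply: quot_lfunP => X; rewrite -(comp_lfunE h) -(comp_lfunE h').
congr (fun_of_lfun _ X); apply: tensk_lfunP => m n.
by rewrite (comp_lfunE h) (comp_lfunE h') -/(tens m n) hh'.
Qed.

Fact tens_lact1 : tens_lact 1 = \1%VF.
Proof. by apply: tens_lfunP => m n; rewrite tens_lact_tens lact1 !lfunE. Qed.
Fact tens_lactM a a' : tens_lact (a * a') = (tens_lact a \o tens_lact a')%VF.
Proof.
apply: tens_lfunP => m n.
by rewrite comp_lfunE !tens_lact_tens lactM comp_lfunE.
Qed.
Fact tens_ract1 : tens_ract 1 = \1%VF.
Proof. by apply: tens_lfunP => m n; rewrite tens_ract_tens ract1 !lfunE. Qed.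
Fact tens_ractM c c' : tens_ract (c * c') = (tens_ract c' \o tens_ract c)%VF.
Proof.
apply: tens_lfunP => m n.
by rewrite comp_lfunE !tens_ract_tens ractM comp_lfunE.
Qed.
Fact tens_lractC a c : (tens_lact a \o tens_ract c = tens_ract c \o tens_lact a)%VF.
Proof.
apply: tens_lfunP => m n.
transitivity (tens_lact a (tens_ract c (tens m n))); first exact: comp_lfunE.
transitivity (tens_ract c (tens_lact a (tens m n))); last exact/esym/comp_lfunE.
apply: etrans (congr1 (tens_lact a) (tens_ract_tens c m n)) _.
apply: etrans (tens_lact_tens a m _) _.
apply: etrans (esym (tens_ract_tens c _ n)) _.
by congr (fun_of_lfun _ _); apply: esym; apply: tens_lact_tens.
Qed.

Definition tensor : bimodule A C :=
  Bimodule tens_lact1 tens_lactM tens_ract1 tens_ractM tens_lractC.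

Lemma tens_lactE a m n : lact tensor a (tens m n) = tens (lact M a m) n.
Proof. exact: tens_lact_tens. Qed.
Lemma tens_ractE c m n : ract tensor c (tens m n) = tens m (ract N c n).
Proof. exact: tens_ract_tens. Qed.

Lemma tens_linearl n : linear (tens^~ n).
Proof. by move=> c m m'; rewrite /tens -linearP -(tk_linearl n). Qed.
Lemma tens_linearr m : linear (tens m).
Proof. by move=> c n n'; rewrite /tens -linearP -(tk_linearr m). Qed.

Lemma tens_balanced m b n : tens (ract M b m) n = tens m (lact N b n).
Proof.
apply/eqP; rewrite -subr_eq0 -linearB qpi_eq0 -tens_diff_tk.
rewrite (coord_vbasis (memvf b)); set e := vbasis _.
rewrite linear_sum sum_lfunE; apply: memv_suml => i _.
rewrite linearZ scale_lfunE memvZ // /tens_rel (big_rem e`_i) ?memt_nth //=.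
by apply: (subvP (addvSl _ _)); rewrite memv_img ?memvf.
Qed.

Lemma tensor_universal (W : vectType k) (f : M -> N -> W) :
    (forall n, linear (f^~ n)) -> (forall m, linear (f m)) ->
    (forall m b n, f (ract M b m) n = f m (lact N b n)) ->
  exists! h : 'Hom(tensor, W), forall m n, h (tens m n) = f m n.
Proof.
move=> fl fr fB.
pose F : M -> {linear N -> W} := fun m =>
  HB.pack (f m) (GRing.isLinear.Build k N W _ (f m) (fr m)).
pose G n : {linear M -> W} :=
  HB.pack (f^~ n) (GRing.isLinear.Build k M W _ (f^~ n) (fl n)).
pose h0 (X : tensk M N) : W :=
  \sum_i \sum_j X i j *: f (r2v (delta_mx 0 i)) (r2v (delta_mx 0 j)).
have h0l : linear h0.
  move=> c X Y; rewrite /h0 scaler_sumr -big_split; apply: eq_bigr => i _ /=.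
  rewrite scaler_sumr -big_split; apply: eq_bigr => j _ /=.
  by rewrite !mxE scalerDl scalerA.
pose h1 : {linear tensk M N -> W} :=
  HB.pack h0 (GRing.isLinear.Build k _ _ _ h0 h0l).
have rvE (U : vectType k) (u : U) :
    u = \sum_i v2r u 0 i *: r2v (delta_mx 0 i).
  apply: v2r_inj; rewrite linear_sum {1}[v2r u]row_sum_delta.
  by apply: eq_bigr => i _; rewrite linearZ /= r2vK.
have [h htk] : {h : 'Hom(tensk M N, W) | forall m n, h (tk m n) = f m n}.
  exists (linfun h1) => m n; rewrite lfunE /= /h0.
  rewrite -[f m n]/(G n m) {2}[m]rvE linear_sum; apply: eq_bigr => i _.
  rewrite linearZ /= -[f _ n]/(F _ n) {2}[n]rvE linear_sum scaler_sumr.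
  by apply: eq_bigr => j _; rewrite linearZ /= tkE scalerA.
have hR X : X \in tens_rel -> h X = 0.
  move=> XR; apply/eqP; rewrite -memv_ker; move: XR; apply/subvP.
  rewrite /tens_rel big_tnth; apply/subv_sumP => i _.
  apply/subvP => _ /memv_imgP[Y _ ->]; rewrite memv_ker -(comp_lfunE h).
  set g := (_ \o _)%VF; suff -> : g = 0 by rewrite lfunE.
  apply: tensk_lfunP => m n; rewrite (comp_lfunE h) tens_diff_tk linearB /=.
  by rewrite !htk fB subrr lfunE.
have hq X : h (vsval (qpi tens_rel X)) = h X.
  by apply/esym/eqP; rewrite -subr_eq0 -linearB; apply/eqP/hR/qpiK.
have h2E X : (h \o linfun vsval)%VF (qpi tens_rel X) = h X.
  by rewrite (comp_lfunE h) [linfun vsval _]lfunE hq.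
exists (h \o linfun vsval)%VF; split=> [m n|h' h'E].
  exact: etrans (h2E _) (htk m n).
apply: tens_lfunP => m n; rewrite h'E; exact: etrans (h2E _) (htk m n).
Qed.

End Tensor.

(* Hom_A(X, Y) for an A-B-bimodule X and a left A-module Y, a left B-module   *)
(* through (b f)(x) = f (x b).                                                *)
Section HomModule.
Variables (k : fieldType) (A B : falgType k) (X : bimodule A B) (Y : lmodule A).

Definition hom_defect_fun a (f : 'Hom(X, Y)) : 'Hom(X, Y) :=
  (f \o lact X a)%VF - (lmod_act Y a \o f)%VF.

Fact hom_defect_linear a : linear (hom_defect_fun a).
Proof.
move=> c f g; rewrite /hom_defect_fun comp_lfunDl comp_lfunDr scalerBr.
by rewrite -comp_lfunZl -comp_lfunZr opprD addrACA.
Qed.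
HB.instance Definition _ a :=
  GRing.isLinear.Build k _ _ _ (hom_defect_fun a) (hom_defect_linear a).

Definition hom_space : {vspace 'Hom(X, Y)} :=
  (\bigcap_(a <- vbasis {:A}) lker (linfun (hom_defect_fun a)))%VS.

Lemma hom_spaceP (f : 'Hom(X, Y)) :
  f \in hom_space <-> (forall a x, f (lact X a x) = lmod_act Y a (f x)).
Proof.
rewrite /hom_space big_tnth memvE; split=> [/subv_bigcapP fA a x | fA].
  rewrite (coord_vbasis (memvf a)) !linear_sum !sum_lfunE linear_sum.
  apply: eq_bigr => i _; rewrite !linearZ !scale_lfunE linearZ /=.
  have lti : (i < size (vbasis {:A}))%N by rewrite size_tuple.
  have := fA (Ordinal lti) isT; rewrite -memvE memv_ker lfunE /= subr_eq0 (tnth_nth 0).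
  by move/eqP/lfunP/(_ x); rewrite !comp_lfunE => ->.
apply/subv_bigcapP => i _; rewrite -memvE memv_ker lfunE /= subr_eq0.
by apply/eqP/lfunP=> x; rewrite !comp_lfunE fA.
Qed.

Let H : vectType k := subvs_of hom_space.

Fact hom_act_closed (f : H) b : (vsval f \o ract X b)%VF \in hom_space.
Proof.
apply/hom_spaceP => a x; rewrite !comp_lfunE.
have /hom_spaceP <- := subvsP f.
by rewrite lractCE.
Qed.

Definition hom_act_fun b (f : H) : H := vsproj hom_space (vsval f \o ract X b)%VF.

Lemma val_hom_act_fun b f : vsval (hom_act_fun b f) = (vsval f \o ract X b)%VF.
Proof. by rewrite vsprojK ?hom_act_closed. Qed.

Fact hom_act_fun_linear b : linear (hom_act_fun b).
Proof.
move=> c f g; apply/val_inj/esym.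
apply: etrans (linearP (@vsval _ _ hom_space) _ _ _) _.
by rewrite /= !val_hom_act_fun comp_lfunZl -comp_lfunDl.
Qed.
HB.instance Definition _ b :=
  GRing.isLinear.Build k _ _ _ (hom_act_fun b) (hom_act_fun_linear b).

Definition hom_act b : 'End(H) := linfun (hom_act_fun b).

Lemma hom_actE b f : vsval (hom_act b f) = (vsval f \o ract X b)%VF.
Proof. by rewrite lfunE /= val_hom_act_fun. Qed.

Fact hom_act_linear : linear hom_act.
Proof.
move=> c b b'; apply/lfunP => f; apply/val_inj.
rewrite add_lfunE scale_lfunE; apply/esym.
apply: etrans (linearP (@vsval _ _ hom_space) _ _ _) _.
by rewrite /= !hom_actE (linearP (ract X)) /= comp_lfunDr -comp_lfunZr.
Qed.
HB.instance Definition _ := GRing.isLinear.Build k _ _ _ hom_act hom_act_linear.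

Fact hom_act1 : hom_act 1 = \1%VF.
Proof.
apply/lfunP => f; apply/val_inj.
by rewrite /= hom_actE ract1 comp_lfun1r lfunE.
Qed.
Fact hom_actM b b' : hom_act (b * b') = (hom_act b \o hom_act b')%VF.
Proof.
apply/lfunP => f; apply/val_inj.
by rewrite /= comp_lfunE !hom_actE ractM comp_lfunA.
Qed.

Definition hom_lmodule : lmodule B := LModule hom_act1 hom_actM.

Lemma hom_lmoduleE b (f : hom_lmodule) (x : X) :
  vsval (lmod_act hom_lmodule b f) x = vsval f (ract X b x).
Proof. by rewrite hom_actE comp_lfunE. Qed.

End HomModule.

(* Hom_A(D(A), A) and A are isomorphic left A-modules. By a theorem of Kerner *)
(* and Yamagata this holds if and only if A is the endomorphism algebra of a  *)
(* faithful right module M over a Frobenius algebra B, with M isomorphic to   *)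
(* its twist by a Nakayama automorphism of B.                                 *)
Definition gendo_Frobenius (k : fieldType) (A : falgType k) :=
  lmod_iso (hom_lmodule (dual_bimodule A) (regular_lmodule A))
           (regular_lmodule A).

Definition dual_tensor_iso (k : fieldType) (A : falgType k) (sigma : algAut A) :=
  bimod_iso (tensor (twist (dual_bimodule A) (aut_inv sigma)) (dual_bimodule A))
            (dual_bimodule A).

(* Main.v *)
(* Write D for the left A-module D(A). A left A-module isomorphism            *)
(* A -> Hom_A(D, A) amounts to a generator t : D -> A, for which every        *)
(* f in Hom_A(D, A) is f(x) = t(x b) with a unique b. Hence                   *)
(* t(x) a = t(x rho(a)) for an algebra endomorphism rho, and the point is     *)
(* that rho is injective. The transpose t' of t, x(t' y) = y(t x), satisfies  *)
(* t(z) x = z t'(x) in D; applying t gives rho o t = t'. As t and t' have the *)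
(* same rank, ker t = ker t'. If rho(a) = 0, then                             *)
(* t'(a y) = rho(a t(y)) = 0, so t(a y) = 0 for all y; transposing,           *)
(* t'(x a) = t'(x) a = 0, so t(x a) = 0 for all x, and a = 0.                 *)
(* Linear forms on D(A)_{s^-1} (x)_A D(A) are the maps                        *)
(* x (x) y |-> x (s^-1 (f y)) with f in Hom_A(D, A), so that a bimodule       *)
(* isomorphism onto D(A) is the same as a generator t with                    *)
(* t(x) s(a) = t(x a), namely x (x) y |-> x . s^-1(t y): take s = rho^-1. Two *)
(* generators differ by a unit, whence the uniqueness of s.                   *)

Require Import Defs.
From HB Require Import structures.
From mathcomp Require Import all_boot all_algebra all_field.

Set Implicit Arguments.
Unset Strict Implicit.
Unset Printing Implicit Defensive.

Import GRing.Theory.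
Local Open Scope ring_scope.

(** Both sides of the equivalence amount to a generator [t] of Hom_A(D(A), A) in the sense of
    [hom_generator]: [gendo_Frobenius_generator] gives this for the first, and
    [dual_tensor_iso_generator] for the second, with the extra condition t(x) s(a) = t(x a).
    [hom_generator_aut] closes the gap by attaching an automorphism to every [t]; its injectivity
    rests on comparing [t] with its transpose. *)

(** * Duality of finite dimensional vector spaces *)

Section Duality.
Variable k : fieldType.
Implicit Types U V : vectType k.

(** Reflexivity V = D(D(V)), with parameters in U: a map into V may be given by its pairings with
    all forms. The coordinates of [f y] are the values of [B] on the dual basis [c]. *)
Lemma dual_representable U V (B : 'Hom(V, k^o) -> U -> k^o) :
    (forall y, linear (B^~ y)) -> (forall x, linear (B x)) ->
  exists f : 'Hom(U, V), forall (x : 'Hom(V, k^o)) y, x (f y) = B x y.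
Proof.
move=> Bl Br; set e := vbasis {:V}.
pose c i : 'Hom(V, k^o) := linfun (coord e i : {linear V -> k^o}).
pose f0 y : V := \sum_i B (c i) y *: e`_i.
have f0l : linear f0.
  move=> a y z; rewrite /f0 scaler_sumr -big_split; apply: eq_bigr => i _ /=.
  by rewrite Br scalerDl scalerA.
pose f1 : {linear U -> V} := HB.pack f0 (GRing.isLinear.Build k _ _ _ f0 f0l).
exists (linfun f1) => x y.
pose G : {linear 'Hom(V, k^o) -> k^o} :=
  HB.pack (B^~ y) (GRing.isLinear.Build k _ _ _ (B^~ y) (Bl y)).
rewrite lfunE /= /f0 linear_sum -[RHS]/(G x).
have -> : x = \sum_(i < \dim {:V}) x e`_i *: c i.
  apply/lfunP=> v; rewrite sum_lfunE {1}(coord_vbasis (memvf v)) linear_sum.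
  by apply: eq_bigr => i _; rewrite linearZ scale_lfunE lfunE /= [RHS]mulrC.
rewrite [RHS]linear_sum; apply: eq_bigr => i _.
rewrite !linearZ /= sum_lfunE (bigD1 i) //= scale_lfunE lfunE /=.
rewrite coord_free ?(basis_free (vbasisP _)) // eqxx [_ *: 1]mulr1.
rewrite big1 ?addr0 => [|j ji]; first by rewrite [LHS]mulrC.
rewrite scale_lfunE lfunE /= coord_free ?(basis_free (vbasisP _)) // eq_sym.
by rewrite (negPf ji) scaler0.
Qed.

Lemma dual_separates V (v : V) : (forall h : 'Hom(V, k^o), h v = 0) -> v = 0.
Proof.
move=> h0; rewrite (coord_vbasis (memvf v)) big1 // => i _.
by have := h0 (linfun (coord (vbasis {:V}) i : {linear V -> k^o}));
  rewrite lfunE /= => ->; rewrite scale0r.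
Qed.

Lemma dual_inj V (v w : V) : (forall h : 'Hom(V, k^o), h v = h w) -> v = w.
Proof.
move=> hvw; apply: subr0_eq; apply: dual_separates => h.
by rewrite linearB /= hvw; exact: subrr.
Qed.

Lemma bidual_eval V (h : 'Hom('Hom(V, k^o), k^o)) :
  exists v, forall x : 'Hom(V, k^o), h x = x v.
Proof.
have [||f fE] := @dual_representable k^o V (fun x c => c *: h x : k^o).
- by move=> y a x z; rewrite linearP scalerDr !scalerA mulrC.
- move=> x a y z; apply: etrans (mulrDl _ _ _) _; congr (_ + _).
  exact/esym/mulrA.
by exists (f 1) => x; rewrite fE scale1r.
Qed.

Lemma eval_at_exists V (v : V) :
  exists e : 'Hom('Hom(V, k^o), k^o), forall x : 'Hom(V, k^o), e x = x v.
Proof.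
pose e0 (x : 'Hom(V, k^o)) : k^o := x v.
have e0l : linear e0 by move=> c x y; rewrite /e0 add_lfunE scale_lfunE.
exists (linfun (HB.pack e0 (GRing.isLinear.Build k _ _ _ e0 e0l)
  : {linear 'Hom(V, k^o) -> k^o})) => x.
by rewrite lfunE.
Qed.

Lemma dual_surjective U V (f : 'Hom(U, V)) :
  (forall h : 'Hom(V, k^o), (forall u, h (f u) = 0) -> h = 0) ->
  limg f = fullv.
Proof.
move=> fh; apply/eqP; rewrite eqEsubv subvf; apply/subvP => v _.
suff /eqP: v - projv (limg f) v = 0.
  by rewrite subr_eq0 => /eqP->; rewrite memv_proj.
apply: dual_separates => h.
have /lfunP/(_ v) : (h \o (\1 - projv (limg f)))%VF = 0.
  apply: fh => u; rewrite comp_lfunE add_lfunE opp_lfunE id_lfunE.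
  by rewrite projv_id ?memv_img ?memvf // subrr linear0.
by rewrite comp_lfunE add_lfunE opp_lfunE id_lfunE lfunE.
Qed.

Lemma lfun_bijective U V (f : 'Hom(U, V)) :
  (forall u, f u = 0 -> u = 0) -> limg f = fullv -> bijective f.
Proof.
move=> f0 ff; have kf : lker f == 0%VS.
  rewrite -subv0; apply/subvP => u; rewrite memv_ker memv0 => /eqP/f0 ->.
  exact: eqxx.
exists (f^-1)%VF; first exact: lker0_lfunK.
by move=> v; rewrite limg_lfunVK // ff memvf.
Qed.

(** Restriction of forms from V to the image W of [f] is onto D(W) and has the same kernel as [g];
    rank-nullity for both maps on D(V) then compares the ranks. *)
Lemma dim_limg_transpose U V (f : 'Hom('Hom(U, k^o), V))
    (g : 'Hom('Hom(V, k^o), U)) :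
  (forall (x : 'Hom(V, k^o)) y, x (f y) = y (g x)) ->
  \dim (limg g) = \dim (limg f).
Proof.
move=> gE; set W := limg f.
pose r : 'Hom('Hom(V, k^o), 'Hom(subvs_of W, k^o)) :=
  precomp _ (linfun (@vsval _ _ W)).
have rE x w : r x w = x (vsval w).
  by rewrite precompE comp_lfunE [linfun _ _]lfunE.
have rs : limg r = fullv.
  apply/eqP; rewrite eqEsubv subvf; apply/subvP => h _.
  (* A form on W extends to V through the projection onto W. *)
  suff -> : h = r (h \o linfun (vsproj W))%VF by rewrite memv_img ?memvf.
  by apply/lfunP => w; rewrite rE comp_lfunE lfunE /= vsvalK.
have kr : lker r = lker g.
  apply/vspaceP => x; rewrite !memv_ker; apply/eqP/eqP => x0.
    apply: dual_separates => y; move/lfunP/(_ (vsproj W (f y))): x0.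
    by rewrite rE vsprojK ?memv_img ?memvf // gE lfunE.
  apply/lfunP => y; have /memv_imgP[u _ yE] := subvsP y.
  by rewrite rE yE gE x0 linear0 lfunE.
have := limg_ker_dim g fullv; rewrite -(limg_ker_dim r fullv) kr rs.
move/addnI => ->; rewrite !dimvf /dim /= muln1.
by [].
Qed.

Lemma dim_lker_transpose V (f g : 'Hom('Hom(V, k^o), V)) :
  (forall x y : 'Hom(V, k^o), x (f y) = y (g x)) ->
  \dim (lker g) = \dim (lker f).
Proof.
move=> fg; have := limg_ker_dim f fullv.
rewrite -(limg_ker_dim g fullv) (dim_limg_transpose fg) !capfv.
by move/addIn ->.
Qed.

End Duality.

(** * Free generators of Hom_A(D(A), A) *)

Section Generator.
Variables (k : fieldType) (A : falgType k).

Local Notation DA := (dual_bimodule A).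
Local Notation HomDA := (hom_lmodule DA (regular_lmodule A)).
Implicit Types (a b : A) (x y z : 'Hom(A, k^o)).

Lemma dual_lactE a x b : (lact DA a x : 'Hom(A, k^o)) b = x (b * a).
Proof. exact: coind_lactE. Qed.

Lemma dual_ractE a x b : (ract DA a x : 'Hom(A, k^o)) b = x (a * b).
Proof. exact: coind_ractE. Qed.

Lemma dual_ract1 x : ract DA 1 x = x.
Proof. by rewrite ract1 id_lfunE. Qed.

Lemma dual_ractM a b x : ract DA (a * b) x = ract DA b (ract DA a x).
Proof. by rewrite ractM comp_lfunE. Qed.

Lemma dual_lact_ractC a b x : lact DA a (ract DA b x) = ract DA b (lact DA a x).
Proof. exact: lractCE. Qed.

Definition left_linear (f : 'Hom(DA, A)) :=
  forall a x, f (lact DA a x) = a * f x.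

(** The last two clauses make b |-> b t injective and surjective from A to Hom_A(D(A), A). *)
Definition hom_generator (t : 'Hom(DA, A)) :=
  [/\ left_linear t,
      forall b, (forall x, t (ract DA b x) = 0) -> b = 0 &
      forall f, left_linear f -> exists b, forall x, f x = t (ract DA b x)].

Lemma left_linear_hom_space (f : 'Hom(DA, A)) :
  left_linear f <-> f \in hom_space DA (regular_lmodule A).
Proof.
split=> [fl | /hom_spaceP fl a x]; last by rewrite fl /= lfunE.
by apply/hom_spaceP => a x; rewrite fl /= lfunE.
Qed.

Lemma gendo_Frobenius_generator :
  gendo_Frobenius A <-> exists t, hom_generator t.
Proof.
split=> [[phi [[psi phiK psiK] phiM]] | [t [tl t0 tf]]].
  have psiM a m : psi (a * m) = lmod_act HomDA a (psi m).
    apply: (can_inj phiK); rewrite phiM !psiK /=; exact/esym/lfunE.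
  have psiE b x : vsval (psi b) x = vsval (psi 1) (ract DA b x).
    by rewrite -{1}(mulr1 b) psiM; exact: hom_lmoduleE.
  exists (vsval (psi 1)); split=> [|b b0|f /left_linear_hom_space fl].
  - exact/left_linear_hom_space/subvsP.
  - apply: (can_inj psiK); apply/val_inj/lfunP => x.
    by rewrite /= psiE b0 psiE linear0 lfunE linear0.
  - exists (phi (Subvs fl)) => x; rewrite -psiE phiK.
    by [].
pose g0 b : HomDA :=
  lmod_act HomDA b (Subvs (proj1 (left_linear_hom_space t) tl)).
have g0l : linear g0.
  by move=> c b b'; rewrite /g0 linearP add_lfunE scale_lfunE.
pose g1 : {linear A -> HomDA} :=
  HB.pack g0 (GRing.isLinear.Build k _ _ _ g0 g0l).
have gE b x : vsval (g1 b) x = t (ract DA b x) by exact: hom_lmoduleE.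
pose g := linfun g1.
have gbij : bijective g.
  apply: lfun_bijective => [b|].
    rewrite lfunE => gb0; apply: t0 => x.
    by rewrite -gE gb0 -(linear0 g1) gE linear0 lfunE linear0.
  apply/eqP; rewrite eqEsubv subvf; apply/subvP => f _.
  have [b fb] := tf _ (proj2 (left_linear_hom_space _) (subvsP f)).
  suff -> : f = g b by rewrite memv_img ?memvf.
  by rewrite lfunE; apply/val_inj/lfunP => x; rewrite [RHS]gE -fb.
have kg : lker g == 0%VS by apply/lker0P/bij_inj.
have [h gK hK] := gbij.
have gVE f : (g^-1)%VF f = h f.
  by rewrite -{1}[f]hK lker0_lfunK.
exists (g^-1)%VF; split.
  by exists g => f; rewrite gVE.
move=> a f; rewrite !gVE; apply: (can_inj gK); rewrite hK -{1}[f]hK.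
rewrite [lmod_act (regular_lmodule A) a _]lfunE /= !(lfunE g1) /= /g0.
by rewrite lmod_actM comp_lfunE.
Qed.

(** * The automorphism attached to a generator *)

Section Automorphism.
Variables (t : 'Hom(DA, A)) (tgen : hom_generator t).

Let tl : left_linear t. Proof. by case: tgen. Qed.

Lemma hom_generator_inj a b :
  (forall x, t (ract DA a x) = t (ract DA b x)) -> a = b.
Proof.
move=> tab; apply/eqP; rewrite -subr_eq0; apply/eqP.
have [_ + _] := tgen; apply=> x; rewrite linearB add_lfunE opp_lfunE linearB /= tab.
exact: subrr.
Qed.

Lemma right_action_exists : exists rho : 'End(A),
  forall a x, t x * a = t (ract DA (rho a) x).
Proof.
pose g0 b : 'Hom(DA, A) := (t \o ract DA b)%VF.
have g0l : linear g0.
  by move=> c b b'; rewrite /g0 linearP comp_lfunDr -comp_lfunZr.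
pose g : 'Hom(A, 'Hom(DA, A)) :=
  linfun (HB.pack g0 (GRing.isLinear.Build k A _ _ g0 g0l)
    : {linear A -> 'Hom(DA, A)}).
pose m0 a : 'Hom(DA, A) := (amulr a \o t)%VF.
have m0l : linear m0.
  by move=> c b b'; rewrite /m0 linearP /= comp_lfunDl -comp_lfunZl.
pose m : 'Hom(A, 'Hom(DA, A)) :=
  linfun (HB.pack m0 (GRing.isLinear.Build k A _ _ m0 m0l)
    : {linear A -> 'Hom(DA, A)}).
(* Since x |-> t(x) a is left linear, [m a] lies in the image of [g], where [g^-1] is a linear right
   inverse; so [rho] is linear by construction. *)
exists (g^-1 \o m)%VF => a x.
have gE b y : g b y = t (ract DA b y) by rewrite lfunE /= comp_lfunE.
have mE y : m a y = t y * a by rewrite lfunE /= comp_lfunE lfunE.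
rewrite -gE comp_lfunE limg_lfunVK ?mE //.
have [|b mb] := (let: And3 _ _ tf := tgen in tf) (m a).
  by move=> b y; rewrite !mE tl mulrA.
suff -> : m a = g b by rewrite memv_img ?memvf.
by apply/lfunP => y; rewrite mb gE.
Qed.

Lemma transpose_exists : exists t' : 'Hom('Hom(A, k^o), A),
  forall x y, x (t' y) = y (t x).
Proof.
apply: (@dual_representable k _ _ (fun x y => y (t x))) => [y c x z|x c y z].
  by rewrite !linearP.
by rewrite add_lfunE scale_lfunE.
Qed.

Lemma hom_generator_aut :
  exists rho : algAut A, forall a x, t x * a = t (ract DA (rho a) x).
Proof.
have [rho rhoE] := right_action_exists; have [t' t'E] := transpose_exists.
have rho1 : rho 1 = 1.
  by apply: hom_generator_inj => x; rewrite -rhoE mulr1 dual_ract1.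
have rhoM a b : rho (a * b) = rho a * rho b.
  by apply: hom_generator_inj => x; rewrite dual_ractM -!rhoE mulrA.
have t'R a x : t' (ract DA a x) = t' x * a.
  by apply: dual_inj => y; rewrite t'E dual_ractE -tl -t'E dual_lactE.
have tt' x z : lact DA (t z) x = ract DA (t' x) z.
  by apply/lfunP => b; rewrite dual_lactE dual_ractE -t'R t'E dual_ractE.
(* Both elements, acting on z from the right under [t], give t(z) t(x). *)
have rho_t x : rho (t x) = t' x.
  apply: hom_generator_inj => z.
  by rewrite -rhoE -tl tt'.
have t_eq0 x : t' x = 0 -> t x = 0.
  have kk : lker t = lker t'.
    apply/eqP; rewrite eqEdim; apply/andP; split.
      by apply/subvP => y; rewrite !memv_ker -rho_t => /eqP->; rewrite linear0.
    by rewrite (dim_lker_transpose t'E).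
  by move/eqP; rewrite -memv_ker -kk memv_ker => /eqP.
have rho_inj a : rho a = 0 -> a = 0.
  move=> a0; have [_ + _] := tgen; apply=> x; apply/t_eq0; rewrite t'R.
  apply: dual_separates => y.
  rewrite -dual_lactE t'E t_eq0 ?linear0 //.
  by rewrite -rho_t tl rhoM a0 mul0r.
have rho_bij : bijective rho.
  apply: lfun_bijective => //; apply: lker0_limgf.
  by apply/eqP/vspaceP => a; rewrite memv_ker memv0;
    apply/eqP/eqP => [/rho_inj|->]; rewrite ?linear0.
have rho_ahom : ahom_in {:A} rho by apply/ahomP_tmp; split.
by exists (@AlgAut _ _ (AHom rho_ahom) rho_bij).
Qed.
End Automorphism.

End Generator.

(** * Linear forms on the twisted tensor square of D(A) *)

Section DualTensor.
Variables (k : fieldType) (A : falgType k) (s : algAut A).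

Local Notation DA := (dual_bimodule A).
Local Notation DAs := (twist DA (aut_inv s)).
Local Notation DADA := (tensor DAs DA).
Local Notation s' := (aut_inv s).
Implicit Types (a b : A) (x y z : 'Hom(A, k^o)) (t f : 'Hom(DA, A)).

Lemma aut_invMr a b : s' (a * s b) = s' a * b.
Proof. by rewrite rmorphM; congr (_ * _); apply: aut_invK. Qed.

Lemma dual_tensor_form_exists f : left_linear f ->
  exists h : 'Hom(DADA, k^o),
    forall x y, h (tens (x : DAs) (y : DA)) = x (s' (f y)).
Proof.
move=> fl.
have [n c x z|m c x z|m b n|h [hE _]] := @tensor_universal k A A A DAs DA k^o
    (fun (x : 'Hom(A, k^o)) y => x (s' (f y))).
- by rewrite add_lfunE scale_lfunE.
- by rewrite !linearP.
- by rewrite twist_ractE dual_ractE fl rmorphM.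
by exists h.
Qed.

(** Pairing with x represents [h] by a map [g]; balancing gives g(a y) = s^-1(a) g(y), so composing
    with [s] restores left linearity. *)
Lemma dual_tensor_form_rep (h : 'Hom(DADA, k^o)) :
  exists2 f, left_linear f &
    forall x y, h (tens (x : DAs) (y : DA)) = x (s' (f y)).
Proof.
have [y c x z|x c y z|g gE] := @dual_representable k DA A
    (fun x y => h (tens (x : DAs) (y : DA))).
- by rewrite [X in h X]tens_linearl linearP.
- by rewrite [X in h X]tens_linearr linearP.
exists (s \o g)%VF => [a y|x y]; last by rewrite comp_lfunE aut_invK gE.
rewrite !comp_lfunE -{2}[a](aut_invVK s) -rmorphM; congr (s _).
apply: dual_inj => x.
rewrite gE -dual_ractE gE -twist_ractE.
by rewrite tens_balanced.
Qed.

Lemma dual_tensor_iso_generator :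
  dual_tensor_iso s <->
  exists2 t, hom_generator t & forall a x, t x * s a = t (ract DA a x).
Proof.
split=> [[phi [[psi phiK psiK] phil phir]] | [t tgen ts]].
  (* [t] represents the form w |-> phi(w)(1). Right and left linearity of [phi] compute phi(x (x)
     y)(b) in two ways, whose comparison is the relation between [t] and [s]. *)
  have [e1 e1E] := eval_at_exists (1 : A).
  have [t tl tE] := dual_tensor_form_rep (e1 \o phi)%VF.
  have phiE x y :
      (phi (tens (x : DAs) (y : DA)) : 'Hom(A, k^o)) 1 = x (s' (t y)).
    by rewrite -tE comp_lfunE e1E.
  have phi_ract b x y :
      (phi (tens (x : DAs) (y : DA)) : 'Hom(A, k^o)) b
      = x (s' (t (ract DA b y))).
    by rewrite -phiE -tens_ractE phir dual_ractE mulr1.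
  have phi_lact b x y :
      (phi (tens (x : DAs) (y : DA)) : 'Hom(A, k^o)) b = x (s' (t y) * b).
    rewrite -dual_lactE -phiE -[lact DA b x]/(lact DAs b x).
    by rewrite -tens_lactE phil dual_lactE mul1r.
  exists t; first split=> // [b b0|f fl].
  - apply: dual_separates => x; have [e eE] := eval_at_exists b.
    rewrite -eE -(psiK x) -comp_lfunE.
    have -> : (e \o phi)%VF = 0; last by rewrite lfunE.
    apply: tens_lfunP => m n.
    by rewrite comp_lfunE eE phi_ract b0 linear0 !lfunE linear0.
  - have [h hE] := dual_tensor_form_exists fl.
    have kphi : lker phi == 0%VS by apply/lker0P/(can_inj phiK).
    have [b bE] := bidual_eval (h \o phi^-1)%VF.
    exists b => y; apply: (can_inj (aut_invVK s)).
    apply: dual_inj => x.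
    rewrite -hE -phi_ract -bE comp_lfunE.
    by rewrite lker0_lfunK.
  - move=> a x; apply: (can_inj (aut_invVK s)).
    apply: dual_inj => z.
    by rewrite -phi_ract phi_lact aut_invMr.
have [tl t0 tf] := tgen.
have [n c x z|m c x z|m b n|phi [phiE _]] := @tensor_universal k A A A DAs DA DA
    (fun x y => ract DA (s' (t y)) x).
- by rewrite linearP.
- by rewrite !linearP add_lfunE scale_lfunE.
- by rewrite twist_ractE tl rmorphM dual_ractM.
exists phi; split.
- apply: lfun_bijective => [w w0|].
    apply: dual_separates => h.
    have [f fl fE] := dual_tensor_form_rep h; have [b bE] := tf _ fl.
    have [e eE] := eval_at_exists b.
    (* Every form on the tensor product factors through [phi], so [phi] is injective. *)
    have -> : h = (e \o phi)%VF; last by rewrite comp_lfunE w0 linear0.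
    apply: tens_lfunP => m n; rewrite comp_lfunE fE bE -ts aut_invMr.
    by rewrite phiE eE dual_ractE.
  apply: dual_surjective => h h0; have [b bE] := bidual_eval h.
  suff b0 : b = 0 by apply/lfunP => x; rewrite bE b0 linear0 lfunE.
  apply: t0 => y; rewrite -ts -[t y](aut_invVK s) -rmorphM.
  have -> : s' (t y) * b = 0; last exact: linear0.
  by apply: dual_separates => x; rewrite -dual_ractE -phiE -bE h0.
- move=> a w; suff /lfunP/(_ w) : (phi \o lact DADA a = lact DA a \o phi)%VF.
    by rewrite (comp_lfunE phi) (comp_lfunE (lact DA a)).
  apply: tens_lfunP => m n; rewrite (comp_lfunE phi) (comp_lfunE (lact DA a)).
  by rewrite [X in phi X]tens_lactE !phiE dual_lact_ractC.
- move=> a w; suff /lfunP/(_ w) : (phi \o ract DADA a = ract DA a \o phi)%VF.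
    by rewrite (comp_lfunE phi) (comp_lfunE (ract DA a)).
  apply: tens_lfunP => m n; rewrite (comp_lfunE phi) (comp_lfunE (ract DA a)).
  by rewrite [X in phi X]tens_ractE !phiE -ts aut_invMr dual_ractM.
Qed.

End DualTensor.

Theorem mainTheorem1 (k : fieldType) (A : falgType k) :
  (gendo_Frobenius A <-> exists sigma : algAut A, dual_tensor_iso sigma) /\
  (forall sigma tau : algAut A,
     dual_tensor_iso sigma -> dual_tensor_iso tau ->
     exists2 u : A, u \is a GRing.unit &
       forall x : A, tau x = u * sigma x * u^-1).
Proof.
split=> [|s r /dual_tensor_iso_generator[t tgen ts]
               /dual_tensor_iso_generator[w wgen wr]].
  apply: iff_trans (gendo_Frobenius_generator A) _; split=> [[t tgen]|[s]].
    have [rho rhoE] := hom_generator_aut tgen.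
    exists (aut_inv rho); apply/dual_tensor_iso_generator.
    by exists t => // a x; rewrite rhoE aut_invVK.
  by move/dual_tensor_iso_generator=> [t tgen _]; exists t.
have [tl _ tf] := tgen; have [wl _ wf] := wgen.
have [u uE] := tf _ wl; have [v vE] := wf _ tl.
have vu : v * u = 1.
  apply: (hom_generator_inj tgen) => x.
  by rewrite dual_ractM -uE -vE dual_ract1.
have uv : u * v = 1.
  apply: (hom_generator_inj wgen) => x.
  by rewrite dual_ractM -vE -uE dual_ract1.
(* Compute t(x a u) twice: it is t(x) s(a) s(u), and also w(x a) = w(x) r(a) = t(x) s(u) r(a). Hence
   conjugation by s(v) = s(u)^-1 carries [s] to [r]. *)
have su_r a : s a * s u = s u * r a.
  have -> : s u * r a = s (aut_inv s (s u * r a)) by rewrite aut_invVK.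
  rewrite -rmorphM; congr (s _); apply: (hom_generator_inj tgen) => x.
  by rewrite -(ts (aut_inv s _)) aut_invVK mulrA ts -uE wr uE dual_ractM.
have svu : s v * s u = 1 by rewrite -rmorphM vu rmorph1.
have suv : s u * s v = 1 by rewrite -rmorphM uv rmorph1.
have sv_unit : s v \is a GRing.unit by apply/unitrP; exists (s u).
exists (s v) => // x; apply: (mulIr sv_unit); rewrite mulrVK //.
by rewrite -[s x]mulr1 -suv (mulrA (s x)) su_r !mulrA svu mul1r.
Qed.
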